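(* For every integer $t\ge 1$ there exists an integer $n_0=n_0(t)\ge t$ such that the following holds for all integers $n\ge n_0$ and $k\ge 2$. Let $\mathscr{F}\subseteq\mathcal{K}_n(n,\ldots,n)$ be a $t$-intersecting family, where $\mathcal{K}_n(n,\ldots,n)$ has $k$ parts. Then \[ |\mathscr{F}|\le\frac{\big((n-t)_{n-t}\big)^{k}}{(n-t)!}. \] Furthermore, equality is attained if and only if $\mathscr{F}$ is a $t$-star of $\mathcal{K}_n(n,\ldots,n)$.
   Context: For a positive integer $n$, $[n]=\{1,\ldots,n\}$. For non-negative integers $b\le a$, $(a)_b=\frac{a!}{(a-b)!}$; in particular $(n-t)_{n-t}=(n-t)!$. $\mathcal{K}(n,\ldots,n)$ (with $k$ parts) denotes the complete $k$-partite $k$-graph all of whose $k$ parts are (disjoint) copies of $[n]$; its edges are identified with the $k$-tuples $(x_1,\ldots,x_k)\in[n]^k$. An $r$-matching is a set of $r$ pairwise vertex-disjoint edges, i.e. a set of $r$ such $k$-tuples any two of which differ in every coordinate. $\mathcal{K}_r(n,\ldots,n)$ is the set of all $r$-matchings of $\mathcal{K}(n,\ldots,n)$; so $\mathcal{K}_n(n,\ldots,n)$ is the set of perfect matchings. A family $\mathscr{F}\subseteq\mathcal{K}_n(n,\ldots,n)$ is $t$-intersecting if any two members of $\mathscr{F}$ share at least $t$ edges. A $t$-star of $\mathcal{K}_n(n,\ldots,n)$ is a family of the form $\{M\in\mathcal{K}_n(n,\ldots,n): C\subseteq M\}$ for some $t$-matching $C\in\mathcal{K}_t(n,\ldots,n)$.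 *)

(* Defs.v *)
From mathcomp Require Import all_boot.

Set Implicit Arguments.
Unset Strict Implicit.
Unset Printing Implicit Defensive.

(* The edges of the complete k-partite k-graph K(n,...,n), as k-tuples; the
   ground set {1, ..., n} of each part is represented by 'I_n. *)
Notation edge n k := {ffun 'I_k -> 'I_n}.

Definition edge_disjoint (n k : nat) (e f : edge n k) : bool :=
  [forall i : 'I_k, e i != f i].

(* K_r(n,...,n) *)
Definition matchings (n k r : nat) : {set {set edge n k}} :=
  [set M : {set edge n k} |
     (#|M| == r) &&
     [forall e in M, forall f in M, (e != f) ==> edge_disjoint e f]].

Definition t_intersecting (n k t : nat) (F : {set {set edge n k}}) : Prop :=
  forall M N, M \in F -> N \in F -> t <= #|M :&: N|.

Definition t_star (n k t : nat) (F : {set {set edge n k}}) : Prop :=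
  exists2 C, C \in matchings n k t &
    F = [set M in matchings n k n | C \subset M].

(* Main.v *)
Require Import Defs.
From mathcomp Require Import all_boot.
From mathcomp Require Import zify.

(** Spread approximation, in the style of Kupavskii and Zakharov.  Fix
    q = 4(t+1) and s ~ sqrt n, and let R = D ^ (k-1) with D a large multiple of
    s.  Call a set B of at most q edges a core if some subfamily of F, all of
    whose members contain B, is R-spread over B.  The members of F that contain
    no core form a tiny family, since its dense link over a largest possible set
    would give a core unless that set has more than q edges.  In a random
    4-colouring of the edges, each of two spread families has, with probability
    more than 1/2, a member using only its own two colours outside its core;
    two rounds of minimal fragments suffice for this because R is much larger
    than s and n / s.  Hence any two cores share at least t edges.  If the cores have no common t-subset, all of them contain
    sets from a bounded list of (t+1)-sets, and F is too small.  Otherwise F is a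
    subfamily of a t-star up to a tiny remainder, and one member M0 outside
    the star would exclude every member of the star that meets M0 only inside
    the centre, which outnumber the remainder. *)

Set Implicit Arguments.
Unset Strict Implicit.
Unset Printing Implicit Defensive.

(** * Elementary estimates for powers, factorials and binomials *)

Lemma leq_expl m n e : m <= n -> m ^ e <= n ^ e.
Proof. by case: e => // e lemn; rewrite leq_exp2r. Qed.

(* Bernoulli's inequality (1 - 1/(n+1))^h >= 1 - h/(n+1), cleared of denominators. *)
Lemma bernoulli_succ n h : h <= n.+1 -> (n.+1 - h) * n.+1 ^ h <= n.+1 * n ^ h.
Proof.
elim: h => [|h IHh] lehn; first by rewrite subn0.
rewrite !expnS; have := IHh (ltnW lehn).
move: (n ^ h) (n.+1 ^ h) => x y; have [d ->] : exists d, n = h + d.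
  by exists (n - h); lia.
have -> : (h + d).+1 - h = d.+1 by lia.
have -> : (h + d).+1 - h.+1 = d by lia.
nia.
Qed.

(** Bernoulli with exponent [uphalf n] bounds the ratio by 2, and squaring gives 4. For odd [n] the
    exponent is then one too large, and cancelling [n.+1] against the smaller [n] is harmless. *)
Lemma expn_succ_le n : n.+1 ^ n <= 4 * n ^ n.
Proof.
have [->//|n_gt0] := posnP n.
have half_le : n.+1 ^ uphalf n <= 2 * n ^ uphalf n.
  have := @bernoulli_succ n (uphalf n); have := uphalf_half n.
  have := odd_double_half n; rewrite -!muln2.
  move: (uphalf n) (n./2) (odd n) => h g [] /= def_n -> /(_ ltac:(lia));
    move: (n ^ _) (n.+1 ^ _) => x y; nia.
have sq_le : n.+1 ^ (n + odd n) <= 4 * n ^ (n + odd n).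
  have -> : n + odd n = uphalf n * 2.
    by have := odd_double_half n; rewrite uphalf_half -!muln2; case: (odd n); lia.
  by rewrite !expnM -(expnMn 2 _ 2) leq_sqr.
case: (odd n) sq_le => /=; last by rewrite !addn0.
by rewrite !addn1 !expnSr; move: (n ^ n) (n.+1 ^ n) => x y; nia.
Qed.

(** Induction lowering [n] and [b] together: while the exponent is at most [n], passing from powers
    of [n.+1] to powers of [n] costs at most the factor 4 of [expn_succ_le]. *)
Lemma expn_fact_le b n : b <= n -> n ^ b * (n - b)`! <= 4 ^ b * n`!.
Proof.
elim: n b => [|n IHn] [|b] // lebn.
have expn_le : n.+1 ^ b <= 4 * n ^ b.
  have [n0|n_gt0] := posnP n; first by move: lebn; rewrite n0; case: b.
  have n_b_gt0 : 0 < n ^ (n - b) by rewrite expn_gt0 n_gt0.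
  rewrite -(leq_pmul2r n_b_gt0) -mulnA -expnD subnKC //.
  apply: leq_trans (expn_succ_le n).
  by rewrite -[X in _ <= _ ^ X](subnKC (lebn : b <= n)) expnD leq_mul2l leq_expl ?orbT.
rewrite subSS !expnS factS -mulnA [4 * _ * _]mulnCA -[4 * _ * _]mulnA.
rewrite leq_mul2l; apply/orP; right.
apply: leq_trans (leq_mul expn_le (leqnn _)) _.
by rewrite -mulnA leq_mul2l IHn.
Qed.

Lemma ffact_le_expn n j : n ^_ j <= n ^ j.
Proof.
rewrite ffact_prod -[in leqRHS](card_ord j) -prod_nat_const.
by apply: leq_prod => i _; apply: leq_subr.
Qed.

(** The diagonal case j^j <= 4^j j! of [expn_fact_le] plays the role of Stirling's formula. *)
Lemma bin_expn_le n j : 'C(n, j) * j ^ j <= 4 ^ j * n ^ j.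
Proof.
have := @expn_fact_le j j (leqnn j); rewrite subnn fact0 muln1 => lejj.
apply: leq_trans (leq_mul (leqnn _) lejj) _.
by rewrite mulnCA leq_mul2l bin_ffact ffact_le_expn orbT.
Qed.

Lemma bin_le_expn n j : 'C(n, j) <= n ^ j.
Proof.
apply: leq_trans (leq_pmulr _ (fact_gt0 j)) _; rewrite bin_ffact.
exact: ffact_le_expn.
Qed.

Lemma sum_geometric_le (B : nat -> nat) r Y n :
  (forall j, j < n -> (2 * r) ^ j.+1 * B j.+1 <= Y) ->
  r * \sum_(j < n) B j.+1 <= Y.
Proof.
move=> B_le; have [->//|r_gt0] := posnP r.
(* The extra [Y] makes the induction close: [r] times the sum of [n] terms is at most (1 - 2^-n)
   Y. *)
suff: 2 ^ n * (r * \sum_(j < n) B j.+1) + Y <= 2 ^ n * Y.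
  have := expn_gt0 2 n; move: (2 ^ n) (r * _) => x y /=; nia.
elim: n B_le => [|n IHn] B_le; first by rewrite big_ord0 !muln0 mul1n.
have {}IHn := IHn (fun j ltjn => B_le j (ltnW ltjn)).
have : 2 ^ n.+1 * (r * B n.+1) <= Y.
  apply: leq_trans (B_le n (leqnn _)); rewrite mulnA leq_mul2r expnMn.
  by rewrite leq_mul2l [r ^ n.+1]expnS leq_pmulr ?expn_gt0 ?r_gt0 // !orbT.
by rewrite big_ord_recr /= expnS; move: (2 ^ n) (\sum_(_ < _) _) IHn => x y; nia.
Qed.

Lemma leq_card_bigcup (I T : finType) (P : pred I) (A : I -> {set T}) :
  #|\bigcup_(i | P i) A i| <= \sum_(i | P i) #|A i|.
Proof.
elim/big_rec2: _ => [|i n U _ leUn]; first by rewrite cards0.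
by apply: leq_trans (leq_card_setU _ _) _; rewrite leq_add2l.
Qed.

(** * Minimal fragments and random colourings *)

Section Fragments.

Variables (X C J : finType).
Implicit Types (A U : {set X}) (I : {set J}) (T : J -> {set X}).
Implicit Types (c : {ffun X -> C}) (a : C).

(** The minimum fragment of Park and Pham. The default [i] of the arg min is itself a candidate
    whenever [i \in I]. *)
Definition fragment I T A i :=
  T [arg min_(j < i | (j \in I) && (T j \subset A :|: T i)) #|T j :\: A|] :\: A.

Lemma fragmentP I T A i : i \in I ->
  exists j, [/\ j \in I, T j \subset A :|: T i, fragment I T A i = T j :\: A &
    forall j', j' \in I -> T j' \subset A :|: T i ->
      #|fragment I T A i| <= #|T j' :\: A| ].
Proof.
move=> Ii; rewrite /fragment; case: arg_minnP => [|j /andP[Ij Tj] minj].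
  by rewrite Ii subsetUr.
by exists j; split=> // j' Ij' Tj'; apply: minj; rewrite Ij'.
Qed.

Lemma fragment_sub I T A i : i \in I -> fragment I T A i \subset T i.
Proof.
by case/(fragmentP T A) => j [_ Tj -> _]; rewrite subDset.
Qed.

Lemma fragment_disjoint I T A i : [disjoint fragment I T A i & A].
Proof. by rewrite disjoints_subset /fragment setDE subsetIr. Qed.

Definition colour_class c a := [set x | c x == a].

Definition recolour c U a : {ffun X -> C} :=
  [ffun x => if x \in U then a else c x].

Lemma colour_class_recolour c U a :
  colour_class (recolour c U a) a = colour_class c a :|: U.
Proof. by apply/setP=> x; rewrite !inE ffunE orbC; case: ifP; rewrite ?eqxx. Qed.

Lemma card_recolour_preim c' U a :
  #|[set c | recolour c U a == c']| <= #|C| ^ #|U|.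
Proof.
rewrite -(card_pffun_on a (mem U) (mem C)).
pose restr c : {ffun X -> C} := [ffun x => if x \in U then c x else a].
rewrite -(card_in_imset (f := restr)).
  apply/subset_leq_card/subsetP=> _ /imsetP[c _ ->].
  apply/pffun_onP; split=> [|x _]; last by rewrite inE.
  by apply/subsetP=> x; rewrite inE ffunE; case: ifP; rewrite ?eqxx.
move=> c1 c2; rewrite !inE => /eqP eq1 /eqP eq2 /ffunP eq12.
apply/ffunP=> x; have := eq12 x; rewrite !ffunE; case: ifP => // xU _.
by have /ffunP/(_ x) := etrans eq1 (esym eq2); rewrite !ffunE xU.
Qed.

(* Each pair (c, i) is encoded by the recoloured c', the fragment U, the index
   i and the old colours on U.  By minimality U lies in any T j contained in
   the class of c', hence in one chosen from c' alone, and the spread hypothesis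
   counts the i with U \subset T i. *)
Lemma fragment_count (I : {ffun X -> C} -> {set J})
    (T : {ffun X -> C} -> J -> {set X}) (a : C) (m L R d : nat) :
    (forall c i U, i \in I c -> U \subset T c i ->
       [disjoint U & colour_class c a] ->
       I (recolour c U a) = I c /\ T (recolour c U a) = T c) ->
    (forall c i, i \in I c -> #|T c i| <= m) ->
    (forall c U, R ^ #|U| * #|[set i in I c | U \subset T c i]| <= L) ->
  R ^ d * #|[set p | (p.2 \in I p.1) &&
      (#|fragment (I p.1) (T p.1) (colour_class p.1 a) p.2| == d)]|
    <= #|{ffun X -> C}| * ('C(m, d) * #|C| ^ d * L).
Proof.
move=> recol size_T spread; set Bad := [set p | _].
(* [S c] depends on [c] alone, so a fragment of size [d] costs only a choice among the [d]-subsets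
   of one set of size at most [m]. *)
pose S c := if [pick j in I c | T c j \subset colour_class c a] is Some j
            then T c j else set0.
pose US c := [set U : {set X} | (U \subset S c) && (#|U| == d)].
pose Q c U := setX [set c' | recolour c' U a == c] [set i in I c | U \subset T c i].
have subBad : Bad \subset \bigcup_c \bigcup_(U in US c) Q c U.
  apply/subsetP=> -[c i]; rewrite inE /= => /andP[Ii /eqP sz].
  pose U := fragment (I c) (T c) (colour_class c a) i.
  have sUT : U \subset T c i by apply: fragment_sub.
  have dUc : [disjoint U & colour_class c a] by apply: fragment_disjoint.
  have [eqI eqT] := recol c i U Ii sUT dUc.
  apply/bigcupP; exists (recolour c U a) => //; apply/bigcupP; exists U; last first.
    by rewrite !inE /= eqxx eqI eqT Ii.
  rewrite !inE sz eqxx andbT /S eqI eqT colour_class_recolour.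
  have [j [Ij Tj Uj minj]] := fragmentP (T c) (colour_class c a) Ii.
  case: pickP => [j' /andP[Ij' sTj']|/(_ j)]; last first.
    by rewrite Ij -subDset -Uj subxx.
  (* [j'] competes with [j] in the minimisation for [i], so its part outside the old class, being
     contained in [U], is all of [U]. *)
  have sj'U : T c j' :\: colour_class c a \subset U by rewrite subDset.
  have sj' : T c j' \subset colour_class c a :|: T c i.
    by apply: subset_trans sTj' _; rewrite setUS.
  have /eqP <- : T c j' :\: colour_class c a == U.
    by rewrite eqEcard sj'U minj.
  exact: subsetDl.
have cardQ c U : U \in US c -> R ^ d * #|Q c U| <= #|C| ^ d * L.
  rewrite inE => /andP[_ /eqP szU]; rewrite cardsX mulnCA -szU.
  by apply: leq_mul; [apply: card_recolour_preim | apply: spread].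
have cardUS c : #|US c| <= 'C(m, d).
  rewrite cards_draws; apply: leq_bin2l; rewrite /S.
  by case: pickP => [j /andP[Ij _]|_]; [apply: size_T | rewrite cards0].
apply: leq_trans (leq_mul (leqnn _) (subset_leq_card subBad)) _.
apply: leq_trans (leq_mul (leqnn _) (leq_card_bigcup _ _)) _.
rewrite big_distrr /= -sum_nat_const; apply: leq_sum => c _.
apply: leq_trans (leq_mul (leqnn _) (leq_card_bigcup _ _)) _.
rewrite big_distrr /= -mulnA; apply: leq_trans (leq_mul (cardUS c) (leqnn _)).
by rewrite -sum_nat_const; apply: leq_sum => U; apply: cardQ.
Qed.

(** Sum of [fragment_count] over the sizes above [lo]; the weight 32 = 2 * 16 leaves a geometric
    series and the saving 16. *)
Lemma fragment_count_tail (I : {ffun X -> C} -> {set J})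
    (T : {ffun X -> C} -> J -> {set X}) (a : C) (m L R lo : nat) :
    (forall c i U, i \in I c -> U \subset T c i ->
       [disjoint U & colour_class c a] ->
       I (recolour c U a) = I c /\ T (recolour c U a) = T c) ->
    (forall c i, i \in I c -> #|T c i| <= m) ->
    (forall c U, R ^ #|U| * #|[set i in I c | U \subset T c i]| <= L) ->
    0 < R -> (forall d, lo < d -> 32 ^ d * ('C(m, d) * #|C| ^ d) <= R ^ d) ->
  16 * #|[set p | (p.2 \in I p.1) &&
      (lo < #|fragment (I p.1) (T p.1) (colour_class p.1 a) p.2|)]|
    <= #|{ffun X -> C}| * L.
Proof.
move=> recol size_T spread R_gt0 R_ge.
pose fr (p : {ffun X -> C} * J) := #|fragment (I p.1) (T p.1) (colour_class p.1 a) p.2|.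
pose E d := [set p | (p.2 \in I p.1) && (fr p == d)].
pose B d := if lo < d then #|E d| else 0.
have B_le d : d < m -> (2 * 16) ^ d.+1 * B d.+1 <= #|{ffun X -> C}| * L.
  move=> _; rewrite /B; case: ifP => [lod|_]; last by rewrite muln0.
  have := fragment_count d.+1 recol size_T spread.
  rewrite -[X in R ^ _ * X]/#|E d.+1| => le1.
  rewrite -(leq_pmul2l (_ : 0 < R ^ d.+1)) ?expn_gt0 ?R_gt0 // mulnCA.
  apply: leq_trans (leq_mul (leqnn _) le1) _.
  rewrite mulnCA [X in _ <= X]mulnCA leq_mul2l mulnA leq_mul2r.
  by rewrite (R_ge _ lod) !orbT.
apply: leq_trans (sum_geometric_le B_le); rewrite leq_mul2l /=.
apply: leq_trans (_ : #|\bigcup_(d < m | lo < d.+1) E d.+1| <= _).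
  apply/subset_leq_card/subsetP=> p; rewrite inE => /andP[Ip lt_lo].
  have lt_m : (fr p).-1 < m.
    rewrite prednK; last exact: leq_ltn_trans lt_lo.
    by apply: leq_trans (size_T _ _ Ip); apply/subset_leq_card/fragment_sub.
  apply/bigcupP; exists (Ordinal lt_m); rewrite /= prednK ?(leq_ltn_trans _ lt_lo) //.
  by rewrite inE Ip eqxx.
apply: leq_trans (leq_card_bigcup _ _) _.
by rewrite big_mkcond /=; apply: leq_sum => d _; rewrite /B.
Qed.

(* Two rounds: the minimal fragments outside class a have size at most s for
   most pairs, and these small fragments are then absorbed by class b. *)
Lemma spread_bad_colourings (I : {set J}) (T : J -> {set X}) (a b : C) (s n R : nat) :
    #|C| = 4 -> a != b -> I != set0 -> 0 < s -> 0 < n ->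
    128 * s <= R -> 512 * n <= s * R ->
    (forall i, i \in I -> #|T i| <= n) ->
    (forall U, R ^ #|U| * #|[set i in I | U \subset T i]| <= 2 * #|I|) ->
  2 * #|[set c | ~~ [exists i in I,
      T i \subset colour_class c a :|: colour_class c b]]| < #|{ffun X -> C}|.
Proof.
move=> cardC neq_ab I_neq0 s_gt0 n_gt0 sR nR size_T spread.
set Bad := [set c | _].
have R_gt0 : 0 < R by lia.
pose T2 c := fragment I T (colour_class c a).
pose I2 c := [set i in I | #|T2 c i| <= s].
pose E1 := [set p : {ffun X -> C} * J | (p.2 \in I) && (s < #|T2 p.1 p.2|)].
pose E2 := [set p | (p.2 \in I2 p.1) &&
  (0 < #|fragment (I2 p.1) (T2 p.1) (colour_class p.1 b) p.2|)].
have E1_le : 16 * #|E1| <= #|{ffun X -> C}| * (2 * #|I|).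
  apply: (@fragment_count_tail (fun=> I) (fun=> T) a n _ R s) => // d lt_sd.
  (* For [s < d], [bin_expn_le] bounds the binomial times s^d by (4n)^d; thus 512 = 32 * 4 * 4, one
     4 being the number of colours. *)
  rewrite cardC -(leq_pmul2l (_ : 0 < s ^ d)) ?expn_gt0 ?s_gt0 //.
  rewrite -expnMn; apply: leq_trans (leq_expl d nR).
  have -> : 512 * n = 32 * (4 * (4 * n)) by lia.
  rewrite mulnCA !(expnMn 32) leq_mul2l; apply/orP; right.
  rewrite mulnA mulnC !(expnMn 4) leq_mul2l; apply/orP; right.
  rewrite mulnC; apply: leq_trans (bin_expn_le n d).
  by rewrite leq_mul2l leq_expl ?orbT // ltnW.
have E2_le : 16 * #|E2| <= #|{ffun X -> C}| * (2 * #|I|).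
  apply: (@fragment_count_tail I2 T2 b s _ R 0) => //.
  - move=> c i U; rewrite inE => /andP[Ii _] sUT dUb.
    (* [U] lies in a first-round fragment, hence outside class [a]; giving it colour [b] leaves the
       first round unchanged. *)
    have eq_a : colour_class (recolour c U b) a = colour_class c a.
      apply/setP=> x; rewrite !inE ffunE; case: ifP => // xU.
      have := disjointFr (fragment_disjoint I T (colour_class c a) i) (subsetP sUT x xU).
      by rewrite inE => ->; rewrite eq_sym (negbTE neq_ab).
    by rewrite /I2 /T2 eq_a.
  - by move=> c i; rewrite inE => /andP[].
  - move=> c U; apply: leq_trans (spread U); rewrite leq_mul2l; apply/orP; right.
    apply/subset_leq_card/subsetP=> i; rewrite !inE => /andP[/andP[Ii _] sU].
    by rewrite Ii (subset_trans sU) ?fragment_sub.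
  move=> d _; rewrite cardC; apply: leq_trans (leq_expl d sR).
  have -> : 128 * s = 32 * (s * 4) by lia.
  by rewrite !expnMn !leq_mul2l leq_mul2r bin_le_expn !orbT.
(* An empty second fragment means that some first fragment lies in class [b], so the set it comes
   from lies in the two classes together, and [c] is not bad. *)
have sub_BE : setX Bad I \subset E1 :|: E2.
  apply/subsetP=> -[c i]; rewrite !inE /= => /andP[badc Ii]; rewrite Ii /=.
  case: ltnP => //= small; rewrite lt0n cards_eq0; apply: contra badc => /eqP frag0.
  have Ii2 : i \in I2 c by rewrite inE Ii.
  have [j [+ _ eqj _]] := fragmentP (T2 c) (colour_class c b) Ii2.
  rewrite inE => /andP[Ij _].
  have [j' [Ij' _ eqj' _]] := fragmentP T (colour_class c a) Ij.
  apply/exists_inP; exists j' => //; rewrite -subDset -eqj'.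
  by rewrite -setD_eq0 -/(T2 c j) -eqj frag0.
(* Double counting: at most a quarter of the colourings are bad. *)
have := leq_trans (subset_leq_card sub_BE) (leq_card_setU _ _); rewrite cardsX.
have I_gt0 : 0 < #|I| by rewrite card_gt0.
have N_gt0 : 0 < #|{ffun X -> C}| by rewrite card_ffun cardC expn_gt0.
by move: (#|Bad|) (#|E1|) (#|E2|) (#|I|) (#|{ffun X -> C}|) E1_le E2_le I_gt0 N_gt0; nia.
Qed.

End Fragments.

(** Each family owns two of the four colours. Fewer than half of the colourings are bad for either
    family, so one is good for both. *)
Lemma spread_cross_disjoint (X J1 J2 : finType) (I1 : {set J1}) (I2 : {set J2})
    (T1 : J1 -> {set X}) (T2 : J2 -> {set X}) (s n R : nat) :
    I1 != set0 -> I2 != set0 -> 0 < s -> 0 < n -> 128 * s <= R -> 512 * n <= s * R ->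
    (forall i, i \in I1 -> #|T1 i| <= n) -> (forall i, i \in I2 -> #|T2 i| <= n) ->
    (forall U : {set X}, R ^ #|U| * #|[set i in I1 | U \subset T1 i]| <= 2 * #|I1|) ->
    (forall U : {set X}, R ^ #|U| * #|[set i in I2 | U \subset T2 i]| <= 2 * #|I2|) ->
  exists i1 i2, [/\ i1 \in I1, i2 \in I2 & [disjoint T1 i1 & T2 i2]].
Proof.
move=> I1n0 I2n0 s0 n0 sR nR sz1 sz2 sp1 sp2.
pose C : finType := (bool * bool)%type.
have cardC : #|C| = 4 by rewrite card_prod card_bool.
have := @spread_bad_colourings X C _ _ _ (true, true) (true, false) s n R
  cardC isT I1n0 s0 n0 sR nR sz1 sp1.
have := @spread_bad_colourings X C _ _ _ (false, true) (false, false) s n R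
  cardC isT I2n0 s0 n0 sR nR sz2 sp2.
set B2 := [set c | _]; set B1 := [set c | _] => lt2 lt1.
have /subsetPn[c _] : ~~ ([set: {ffun X -> C}] \subset B1 :|: B2).
  apply/negP=> /subset_leq_card; rewrite cardsT => leN.
  have := leq_trans leN (leq_card_setU _ _).
  by move: (#|B1|) (#|B2|) (#|{ffun X -> C}|) lt1 lt2 => x y z; clear; lia.
rewrite !inE negb_or !negbK => /andP[/exists_inP[i1 I1i1 s1] /exists_inP[i2 I2i2 s2]].
exists i1, i2; split=> //; rewrite disjoint_subset; apply/subsetP=> x x1.
rewrite inE; apply/negP=> x2; move: (subsetP s1 x x1) (subsetP s2 x x2).
by rewrite !inE; case: (c x) => [[] []].
Qed.

(** * Matchings, their completions and the sizes of stars *)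

Lemma matchingsP n k r (M : {set edge n k}) :
  reflect (#|M| = r /\ forall e f, e \in M -> f \in M -> e != f -> forall i, e i != f i)
          (M \in matchings n k r).
Proof.
rewrite inE; apply: (iffP andP) => [[/eqP szM /forall_inP dM]|[szM dM]]; split=> //.
- by move=> e f Me Mf neq; by have /forall_inP/(_ f Mf)/implyP/(_ neq)/forallP := dM e Me.
- exact/eqP.
apply/forall_inP=> e Me; apply/forall_inP=> f Mf; apply/implyP=> neq.
by apply/forallP; apply: dM.
Qed.

Section PerfectMatchings.

Variables n k : nat.
Implicit Types (B M Q : {set edge n k.+1}) (e f : edge n k.+1) (i : 'I_k.+1) (x : 'I_n).

Definition matching B := B \in matchings n k.+1 #|B|.

Lemma matching_neq B e f i : matching B -> e \in B -> f \in B -> e != f -> e i != f i.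
Proof. by case/matchingsP=> _ dB Be Bf neq; apply: dB. Qed.

Lemma matchingW B r : B \in matchings n k.+1 r -> matching B.
Proof. by case/matchingsP=> szB dB; apply/matchingsP; split. Qed.

Lemma matching_sub B M : B \subset M -> matching M -> matching B.
Proof.
move=> /subsetP sBM /matchingsP[_ dM]; apply/matchingsP; split=> // e f Be Bf.
by apply: dM; apply: sBM.
Qed.

Definition star B := [set M in matchings n k.+1 n | B \subset M].

Lemma in_star M B : (M \in star B) = (M \in matchings n k.+1 n) && (B \subset M).
Proof. by rewrite inE. Qed.

Lemma star_matching M B : M \in star B -> matching B.
Proof. by rewrite in_star => /andP[/matchingW mM /matching_sub]; apply. Qed.

Definition free B i := [set x | [forall e in B, e i != x]].

Lemma card_free B i : matching B -> #|free B i| + #|B| = n.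
Proof.
move=> mB; have <- : #|[set e i | e : edge n k.+1 in B]| = #|B|.
  apply: card_in_imset => e f Be Bf; apply: contra_eq => neq.
  exact: matching_neq mB Be Bf neq.
have -> : free B i = ~: [set e i | e : edge n k.+1 in B].
  apply/setP=> x; rewrite !inE; apply/forall_inP/negP=> [fr /imsetP[e Be eq_x]|nex e Be].
    by have := fr e Be; rewrite eq_x eqxx.
  by apply/eqP=> eq_x; apply: nex; apply/imsetP; exists e.
by rewrite addnC cardsC card_ord.
Qed.

Lemma free_disjoint B e f i : e i \in free B i -> f \in B -> e i != f i.
Proof. by rewrite inE eq_sym => /forall_inP; apply. Qed.

Lemma perfect_cover M i x : M \in matchings n k.+1 n -> exists2 e, e \in M & e i = x.
Proof.
move=> pM; have := card_free i (matchingW pM).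
have /matchingsP[-> _] := pM => /eqP; rewrite -[n in _ == n]add0n eqn_add2r cards_eq0.
move=> /eqP/setP/(_ x); rewrite !inE => /negbT; rewrite negb_forall_in.
by case/exists_inP=> e Me /negbNE/eqP; exists e.
Qed.

Definition new_edges B x :=
  [set e : edge n k.+1 | (e ord0 == x) && [forall i, e i \in free B i]].

Lemma matching_new_edge B x e : matching B -> e \in new_edges B x ->
  matching (e |: B) /\ #|e |: B| = #|B|.+1.
Proof.
move=> mB; rewrite inE => /andP[_ /forallP fr].
have eB : e \notin B.
  by apply/negP=> Be; have := free_disjoint (fr ord0) Be; rewrite eqxx.
split; last by rewrite cardsU1 eB.
apply/matchingsP; split=> // f g; rewrite !in_setU1 => /orP[/eqP->|Bf] /orP[/eqP->|Bg].
- by rewrite eqxx.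
- by move=> _ i; apply: free_disjoint (fr i) Bg.
- by move=> _ i; rewrite eq_sym; apply: free_disjoint (fr i) Bf.
by move=> neq i; apply: matching_neq mB Bf Bg neq.
Qed.

Lemma card_new_edges B x : matching B -> x \in free B ord0 ->
  #|new_edges B x| = (n - #|B|) ^ k.
Proof.
move=> mB xfr.
pose F i : pred 'I_n := if i == ord0 then pred1 x else mem (free B i).
have -> : #|new_edges B x| = #|(family F : simpl_pred (edge n k.+1))|.
  apply: eq_card => e; rewrite !inE; apply/andP/familyP=> [[/eqP ex /forallP fr] i|Fe].
    rewrite /F; case: eqP => [->|_]; first by rewrite inE ex.
    exact: fr.
  have /eqP ex : e ord0 == x by have := Fe ord0; rewrite /F eqxx.
  rewrite ex; split=> //; apply/forallP=> i; have := Fe i; rewrite /F.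
  by case: eqP => [-> _|_ //]; rewrite ex.
rewrite card_family foldrE big_map big_enum big_ord_recl /= {1}/F eqxx card1 mul1n.
transitivity (\prod_(i < k) (n - #|B|)); last by rewrite prod_nat_const card_ord.
apply: eq_bigr => i _.
by apply: (canRL (addnK #|B|)); apply: card_free.
Qed.

(** A perfect matching containing [B] covers the free vertex [x] by exactly one edge, which lies in
    [new_edges B x]. The predicate [P] lets one recursion serve both the full count and the avoiding
    count. *)
Lemma star_recursion (P : pred {set edge n k.+1}) B x : x \in free B ord0 ->
  #|[set M in star B | P M]| =
  \sum_(e in new_edges B x) #|[set M in star (e |: B) | P M]|.
Proof.
move=> xfr.
transitivity (\sum_(M in star B | P M) \sum_(e in new_edges B x) (e \in M : nat)).
  rewrite -sum1dep_card; apply: eq_bigr => M /andP[]; rewrite in_star => /andP[pM sBM] _.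
  have mM := matchingW pM; have [e Me ex] := perfect_cover ord0 x pM.
  have eN : e \in new_edges B x.
    rewrite inE ex eqxx; apply/forallP=> i; rewrite inE; apply/forall_inP=> f Bf.
    apply: matching_neq mM (subsetP sBM f Bf) Me _; apply: contraTneq xfr => ef.
    by rewrite inE negb_forall_in; apply/exists_inP; exists f; rewrite // ef ex negbK.
  rewrite (bigD1 e) //= Me big1 // => f /andP[]; rewrite inE => /andP[/eqP fx _] nfe.
  have [Mf|//] := boolP (f \in M).
  by have := matching_neq ord0 mM Mf Me nfe; rewrite fx ex eqxx.
rewrite exchange_big; apply: eq_bigr => e _; rewrite -sum1dep_card.
rewrite big_mkcond [RHS]big_mkcond; apply: eq_bigr => M _.
rewrite !in_star subUset sub1set; case: (M \in _); case: (B \subset M) => //=.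
all: by case: (e \in M); case: (P M).
Qed.

Lemma card_star B : matching B -> #|star B| = (n - #|B|)`! ^ k.
Proof.
move def_m: (n - #|B|) => m; elim: m => [|m IHm] in B def_m * => mB.
  have szB : #|B| = n by have := card_free ord0 mB; lia.
  rewrite exp1n -(cards1 B); congr #|pred_of_set _|; apply/setP=> M.
  rewrite in_star in_set1; apply/andP/eqP => [[pM sBM]|->]; last first.
    by split=> //; have := mB; rewrite /matching szB.
  have /matchingsP[szM _] := pM.
  by apply/esym/eqP; rewrite eqEcard sBM szB szM leqnn.
have /card_gt0P[x xfr] : 0 < #|free B ord0|.
  by rewrite -(ltn_add2r #|B|) (card_free ord0 mB) add0n -subn_gt0 def_m.
have -> : #|star B| = #|[set M in star B | predT M]|.
  by apply: eq_card => M; rewrite [in RHS]inE andbT.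
rewrite (star_recursion predT xfr) factS expnMn -def_m -(card_new_edges mB xfr).
rewrite -sum_nat_const; apply: eq_bigr => e eN.
have [mB' szB'] := matching_new_edge mB eN.
rewrite -(IHm (e |: B)) //; last by rewrite szB'; lia.
by apply: eq_card => M; rewrite [in LHS]inE andbT.
Qed.

Lemma card_star_le B : #|star B| <= (n - #|B|)`! ^ k.
Proof.
have [->|[M BM]] := set_0Vmem (star B); first by rewrite cards0.
by rewrite card_star // (star_matching BM).
Qed.

(** Two vertices are free in each part. If some edge [q] of [Q] uses only free vertices, changing
    one coordinate of [q] gives an edge that blocks [q], and any completion through it avoids [Q]
    outside [B]. Otherwise every completion does. *)
Lemma avoiding_star_neq0 B Q : 0 < k -> matching B -> matching Q -> #|B|.+2 = n ->
  exists2 M, M \in star B & M :&: Q \subset B.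
Proof.
move=> k_gt0 mB mQ szB.
have subBn B' : matching B' -> exists M, M \in star B'.
  by move=> mB'; apply/card_gt0P; rewrite card_star // expn_gt0 fact_gt0.
have [/exists_inP[q Qq /forallP frq]|noq] :=
    boolP [exists q in Q, [forall i, q i \in free B i]]; last first.
  have [M sM] := subBn B mB; exists M => //.
  have := sM; rewrite in_star => /andP[pM sBM].
  apply/subsetP=> e /setIP[Me Qe]; apply: contraNT noq => Be.
  apply/exists_inP; exists e => //; apply/forallP=> i; rewrite inE.
  apply/forall_inP=> f Bf; apply: matching_neq (matchingW pM) (subsetP sBM f Bf) Me _.
  by apply: contraNneq Be => <-.
pose i1 : 'I_k.+1 := inord 1.
have i1_neq0 : i1 != ord0 by rewrite -val_eqE /= inordK.
have free2 : #|free B i1| = 2.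
  by apply: (@addIn #|B|); rewrite card_free // -[LHS]szB.
have [y yfr yq] : exists2 y, y \in free B i1 & y != q i1.
  have : 0 < #|free B i1 :\ q i1|.
    by rewrite -(ltn_add2l (q i1 \in free B i1)) -cardsD1 frq free2.
  by case/card_gt0P=> y; rewrite !inE => /andP[]; exists y; rewrite ?inE.
pose e : edge n k.+1 := [ffun i => if i == i1 then y else q i].
have e0 : e ord0 = q ord0 by rewrite ffunE eq_sym (negbTE i1_neq0).
have e1 : e i1 = y by rewrite ffunE eqxx.
have eN : e \in new_edges B (q ord0).
  rewrite inE e0 eqxx; apply/forallP=> i; rewrite ffunE.
  by case: eqP => [->|_]; [apply: yfr | apply: frq].
have [mB' szB'] := matching_new_edge mB eN.
have [M sM] := subBn _ mB'; have := sM; rewrite in_star => /andP[pM].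
rewrite subUset sub1set => /andP[Me sBM].
exists M; first by rewrite in_star pM.
apply/subsetP=> f /setIP[Mf Qf]; apply/negPn/negP=> Bf.
have mM := matchingW pM.
have nfe : f != e.
  apply: contraTneq yq => fe; rewrite negbK -e1 -fe.
  have [-> //|nfq] := eqVneq f q.
  by have := matching_neq ord0 mQ Qf Qq nfq; rewrite fe e0 eqxx.
have nfq : f != q.
  apply: contraTneq (matching_neq ord0 mM Mf Me nfe) => ->.
  by rewrite e0 eqxx.
(* The part i1 has only two free vertices, y and q i1, and f i1 would be a third. *)
have : #|[set y; q i1; f i1]| <= #|free B i1|.
  apply/subset_leq_card; rewrite !subUset !sub1set yfr frq inE /=.
  apply/forall_inP=> g Bg; apply: matching_neq mM (subsetP sBM g Bg) Mf _.
  by apply: contraNneq Bf => <-.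
rewrite free2 -setUA !cardsU1 !inE cards1 (negbTE yq) -e1 ![e i1 == _]eq_sym.
have -> /= : (f i1 == e i1) = false by apply/negbTE; apply: matching_neq mM Mf Me nfe.
have -> /= : (q i1 == f i1) = false.
  by rewrite eq_sym; apply/negbTE; apply: matching_neq mQ Qf Qq nfq.
by rewrite ltnn.
Qed.

(** Induction on the number of free vertices: with m+3 of them in each part, at most one of the
    (m+3)^k edges through [x] belongs to [Q], so at least (m+2)^k are left. This loss shifts the
    factorial by one. *)
Lemma card_avoiding_star B Q : 0 < k -> matching B -> matching Q -> #|B|.+2 <= n ->
  ((n - #|B|).-1)`! ^ k <= #|[set M in star B | M :&: Q \subset B]|.
Proof.
move=> k_gt0 mB mQ le_n; move def_m: (n - #|B|.+2) => m.
elim: m => [|m IHm] in B mB le_n def_m *.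
  have szB : #|B|.+2 = n by apply/eqP; rewrite eqn_leq le_n -subn_eq0 def_m.
  have [M sM sQ] := avoiding_star_neq0 k_gt0 mB mQ szB.
  have -> : (n - #|B|).-1 = 1 by lia.
  by rewrite exp1n; apply/card_gt0P; exists M; rewrite inE sM.
have -> : (n - #|B|).-1 = m.+2 by lia.
have /card_gt0P[x xfr] : 0 < #|free B ord0|.
  by rewrite -(ltn_add2r #|B|) (card_free ord0 mB) add0n; apply: ltnW.
rewrite (star_recursion (fun M => M :&: Q \subset B) xfr).
pose N := new_edges B x.
have N_Q : #|N :&: Q| <= 1.
  apply/card_le1P => e /setIP[Ne Qe] f; rewrite [in RHS]inE.
  apply/idP/eqP=> [|->]; last exact/setIP.
  case/setIP=> Nf Qf; apply/eqP; apply: contraTT Ne => nef.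
  have := matching_neq ord0 mQ Qf Qe nef.
  by move: Nf; rewrite !inE => /andP[/eqP-> _]; rewrite eq_sym => /negbTE->.
have N_D : m.+2 ^ k <= #|N :\: Q|.
  have := cardsID Q N; rewrite card_new_edges //.
  have -> : n - #|B| = m.+3 by lia.
  have : m.+2 ^ k < m.+3 ^ k by rewrite ltn_exp2r.
  by move: (#|N :&: Q|) (#|N :\: Q|) N_Q (m.+2 ^ k) (m.+3 ^ k); lia.
rewrite factS expnMn. apply: (leq_trans (leq_mul N_D (leqnn (m.+1`! ^ k)))).
rewrite [leqRHS](big_setID Q) -sum_nat_const /=; apply: leq_trans (leq_addl _ _).
apply: leq_sum => e /setDP[Ne Qe].
have [mB' szB'] := matching_new_edge mB Ne.
have -> : m.+1 = (n - #|e |: B|).-1 by rewrite szB'; lia.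
apply: leq_trans (IHm _ mB' _ _) _; rewrite ?szB'; try lia.
apply/subset_leq_card/subsetP=> M; rewrite !inE => /andP[-> /subsetP sM].
apply/subsetP=> f fMQ; have /setU1P[fe|//] := sM f fMQ.
by move: fMQ Qe; rewrite fe => /setIP[_ ->].
Qed.

End PerfectMatchings.

(** * Spread families, cores and covers by small sets *)

Section SpreadApproximation.

Variable X : finType.
Implicit Types (G F L : {set {set X}}) (B C U M : {set X}).

Definition link G B := [set M in G | B \subset M].

Definition spread_over R G B :=
  [forall U : {set X}, (B \subset U) ==> (R ^ #|U| * #|link G U| <= R ^ #|B| * #|G|)].

Lemma spread_overP R G B U : spread_over R G B -> B \subset U ->
  R ^ #|U| * #|link G U| <= R ^ #|B| * #|G|.
Proof. by move=> /forallP/(_ U)/implyP. Qed.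

(** A point outside [B] lies in at most a fraction 1/R of [G], so discarding the members that meet
    [B' :\: B] loses at most q/R <= 1/2 of [G]. Hence the factor 2 in the spread condition. *)
Lemma spread_prune R q G B B' (G' := [set M in G | [disjoint M & B' :\: B]]) :
    0 < R -> 2 * q <= R -> #|B'| <= q -> G != set0 -> spread_over R G B ->
    {in G, forall M, B \subset M} ->
  G' != set0 /\
  forall U, R ^ #|U| * #|[set M in G' | U \subset M :\: B]| <= 2 * #|G'|.
Proof.
move=> R_gt0 qR szB' Gn0 spG sBG.
have RB_gt0 : 0 < R ^ #|B| by rewrite expn_gt0 R_gt0.
have sGG' : G' \subset G by apply/subsetP=> M; rewrite inE => /andP[].
have subD : G :\: G' \subset \bigcup_(x in B' :\: B) link G (x |: B).
  apply/subsetP=> M /setDP[GM]; rewrite inE GM /= -setI_eq0 => /set0Pn[x /setIP[Mx BBx]].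
  by apply/bigcupP; exists x; rewrite // inE GM subUset sub1set Mx sBG.
have cardD : R * #|G :\: G'| <= q * #|G|.
  apply: leq_trans (leq_mul (leqnn _) (subset_leq_card subD)) _.
  apply: leq_trans (leq_mul (leqnn _) (leq_card_bigcup _ _)) _.
  rewrite big_distrr /=; apply: leq_trans (_ : #|B' :\: B| * #|G| <= _); last first.
    by rewrite leq_mul2r (leq_trans _ szB') ?orbT // subset_leq_card // subsetDl.
  rewrite -sum_nat_const; apply: leq_sum => x /setDP[_ Bx].
  have := spread_overP spG (subsetUr [set x] B).
  by rewrite cardsU1 Bx /= add1n expnS [R * R ^ _]mulnC -mulnA leq_pmul2l.
have G_le : #|G| <= 2 * #|G'|.
  have /eqP := cardsID G' G; rewrite (setIidPr sGG') => /eqP.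
  by move: (#|G|) (#|G'|) (#|G :\: G'|) cardD => x y z; nia.
split=> [|U].
  by rewrite -card_gt0; have := Gn0; rewrite -card_gt0; lia.
(* A witness [M0] forces [U] to be disjoint from [B], so that the exponents add; without one the
   count is zero. *)
have [->|[M0]] := set_0Vmem [set M in G' | U \subset M :\: B].
  by rewrite cards0 muln0.
rewrite inE => /andP[_]; rewrite subsetD => /andP[_ dUB].
apply: leq_trans G_le; rewrite -(leq_pmul2l RB_gt0).
apply: leq_trans (spread_overP spG (subsetUr U B)).
rewrite cardsU (disjoint_setI0 dUB) cards0 subn0 expnD mulnA [R ^ #|B| * _]mulnC.
rewrite leq_mul2l; apply/orP; right; apply/subset_leq_card/subsetP=> M.
rewrite !inE => /andP[/andP[GM _]]; rewrite subsetD GM subUset => /andP[-> _].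
exact: sBG.
Qed.

(** Once each family is pruned by the other's base, a common point outside [B1 :&: B2] must avoid
    both bases, and [spread_cross_disjoint] excludes such points. *)
Lemma spread_pair_meet s n R q G1 G2 B1 B2 :
    0 < s -> 0 < n -> 128 * s <= R -> 512 * n <= s * R -> 2 * q <= R ->
    #|B1| <= q -> #|B2| <= q -> G1 != set0 -> G2 != set0 ->
    spread_over R G1 B1 -> spread_over R G2 B2 ->
    {in G1, forall M, B1 \subset M /\ #|M| <= n} ->
    {in G2, forall M, B2 \subset M /\ #|M| <= n} ->
  exists M1 M2, [/\ M1 \in G1, M2 \in G2 & M1 :&: M2 \subset B1 :&: B2].
Proof.
move=> s_gt0 n_gt0 sR nR qR sz1 sz2 G1n0 G2n0 sp1 sp2 inG1 inG2.
have R_gt0 : 0 < R by lia.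
have [] := spread_prune R_gt0 qR sz2 G1n0 sp1 (fun M GM => (inG1 M GM).1).
set G1' := [set M in G1 | _] => G1'n0 sp1'.
have [] := spread_prune R_gt0 qR sz1 G2n0 sp2 (fun M GM => (inG2 M GM).1).
set G2' := [set M in G2 | _] => G2'n0 sp2'.
have [i|i|M1 [M2 []]] := @spread_cross_disjoint X _ _ G1' G2' (fun M => M :\: B1)
  (fun M => M :\: B2) s n R G1'n0 G2'n0 s_gt0 n_gt0 sR nR _ _ sp1' sp2'.
- rewrite inE => /andP[/inG1[_ szM] _].
  exact: leq_trans (subset_leq_card (subsetDl _ _)) szM.
- rewrite inE => /andP[/inG2[_ szM] _].
  exact: leq_trans (subset_leq_card (subsetDl _ _)) szM.
rewrite !inE => /andP[GM1 d1] /andP[GM2 d2] d12; exists M1, M2; split=> //.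
apply/subsetP=> x /setIP[M1x M2x].
have := disjointFr d1 M1x; have := disjointFr d2 M2x; rewrite !inE.
have [B1x|B1x] := boolP (x \in B1); have [B2x|B2x] := boolP (x \in B2) => //= _ _.
by have := @disjointFr _ _ _ x d12; rewrite !inE M1x M2x B1x B2x => /(_ isT).
Qed.

Definition spread_cores R q F :=
  [set B : {set X} | (#|B| <= q) &&
     [exists G : {set {set X}}, [&& G \subset F, G != set0,
        [forall M in G, B \subset M] & spread_over R G B]]].

Definition uncovered (S F : {set {set X}}) :=
  [set M in F | ~~ [exists B in S, B \subset M]].

(* Among the B with |L| <= R ^ |B| * |L(B)| take a largest one: the link L(B)
   is then R-spread over B, so B would be a core if it were small. *)
Lemma uncovered_link R q F (L := uncovered (spread_cores R q F) F) :
    0 < R -> L != set0 ->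
  exists B, [/\ q < #|B|, link L B != set0 & #|L| <= R ^ #|B| * #|link L B|].
Proof.
move=> R_gt0 Ln0; pose P B := #|L| <= R ^ #|B| * #|link L B|.
have P0 : P set0.
  rewrite /P cards0 mul1n; apply/subset_leq_card/subsetP=> M LM.
  by rewrite inE LM sub0set.
have [B PB maxB] := arg_maxnP (fun B => #|B|) P0.
have linkn0 : link L B != set0.
  rewrite -card_gt0 lt0n; apply: contraL Ln0 => /eqP link0.
  by move: PB; rewrite /P link0 muln0 leqn0 cards_eq0 => ->.
exists B; split=> //; rewrite ltnNge; apply/negP=> szB.
suff coreB : B \in spread_cores R q F.
  have [M] := set0Pn _ linkn0; rewrite !inE => /andP[/andP[_ /exists_inP nex] sBM].
  by apply: nex; exists B.
rewrite inE szB; apply/existsP; exists (link L B); rewrite linkn0 /=.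
apply/and3P; split.
- by apply/subsetP=> M; rewrite !inE => /andP[/andP[]].
- by apply/forall_inP=> M; rewrite inE => /andP[].
apply/forallP=> U; apply/implyP=> sBU.
have le_link : #|link (link L B) U| <= #|link L U|.
  by apply/subset_leq_card/subsetP=> M; rewrite !inE => /andP[/andP[-> _] ->].
(* Maximality of [B] speaks only of strictly larger sets, so [U = B] is treated apart. *)
have [<-|neqBU] := eqVneq B U.
  by rewrite leq_mul2l subset_leq_card ?orbT //; apply/subsetP=> M; rewrite inE => /andP[].
have ltBU : #|B| < #|U| by apply: proper_card; rewrite properEneq neqBU.
have : ~~ P U by apply: contraL ltBU => /maxB; rewrite -leqNgt.
rewrite -ltnNge => /ltnW leU; apply: leq_trans (leq_trans leU PB).
by rewrite leq_mul2l le_link orbT.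
Qed.

(** Fix [B1] in [S], and for each [t]-subset [C] of [B1] a member [w C] not containing [C]. A member
    [B] containing [C] meets [w C] in at least [t] points, so not only inside [C]; it thus contains
    some [x |: C] with [x] in [w C]. *)
Lemma nontrivial_cover t q (S : {set {set X}}) :
    {in S, forall B : {set X}, #|B| <= q} ->
    {in S &, forall B B' : {set X}, t <= #|B :&: B'|} ->
    (forall C : {set X}, #|C| = t -> exists2 B, B \in S & ~~ (C \subset B)) ->
  exists P : {set {set X}}, [/\ #|P| <= 2 ^ q * q, {in P, forall C : {set X}, #|C| = t.+1} &
    {in S, forall B : {set X}, exists2 C : {set X}, C \in P & C \subset B}].
Proof.
move=> szS meetS nontriv.
have [->|[B1 SB1]] := set_0Vmem S.
  by exists set0; rewrite cards0; split=> // B; rewrite inE.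
pose w C := odflt set0 [pick B in S | ~~ (C \subset B)].
have wP C : #|C| = t -> w C \in S /\ ~~ (C \subset w C).
  move=> szC; rewrite /w; case: pickP => [B /andP[]//|noB].
  by have [B SB nsub] := nontriv C szC; have := noB B; rewrite SB nsub.
pose Ts := [set C : {set X} | (C \subset B1) && (#|C| == t)].
exists (\bigcup_(C in Ts) [set x |: C | x in w C :\: C]); split.
- apply: leq_trans (leq_card_bigcup _ _) _.
  apply: leq_trans (_ : #|Ts| * q <= _).
    rewrite -sum_nat_const; apply: leq_sum => C; rewrite inE => /andP[_ /eqP szC].
    apply: leq_trans (leq_imset_card _ _) _.
    apply: leq_trans (subset_leq_card (subsetDl _ _)) _.
    by apply: szS; have [] := wP C szC.
  rewrite leq_mul2r; apply/orP; right.
  apply: leq_trans (_ : #|powerset B1| <= _).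
    by apply/subset_leq_card/subsetP=> C; rewrite !inE => /andP[].
  by rewrite card_powerset leq_exp2l // szS.
- move=> _ /bigcupP[C + /imsetP[x /setDP[_ Cx] ->]]; rewrite inE => /andP[_ /eqP <-].
  by rewrite cardsU1 Cx.
move=> B SB; have [C sC szC] : exists2 C : {set X}, C \subset B1 :&: B & #|C| = t.
  have : 0 < 'C(#|B1 :&: B|, t) by rewrite bin_gt0 meetS.
  rewrite -cards_draws => /card_gt0P[C]; rewrite inE => /andP[sC /eqP szC].
  by exists C.
have [Sw nsub] := wP C szC; have [sC1 sCB] := (subsetIP sC).
have /subsetPn[x /setIP[Bx wx] Cx] : ~~ (B :&: w C \subset C).
  apply: contra nsub => sBwC; have : B :&: w C == C by rewrite eqEcard sBwC szC meetS.
  by move/eqP=> eqC; rewrite -{1}eqC subsetIr.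
exists (x |: C); last by rewrite subUset sub1set Bx.
apply/bigcupP; exists C; first by rewrite inE sC1 szC eqxx.
by apply: imset_f; rewrite inE Cx.
Qed.

End SpreadApproximation.

(** * Stability: large [t]-intersecting families are stars *)

(* q bounds the size of the cores and D ^ k is the spreadness. *)
Lemma extremal_star n k t s q D (F : {set {set edge n k.+1}}) :
    0 < k -> 0 < s -> 128 * s <= D -> 512 * n <= s * D -> 2 * q <= D ->
    (forall b, q < b -> b <= n -> D ^ b * (n - b)`! < (n - t.+1)`!) ->
    t.+2 <= n -> 2 ^ q * q < n - t ->
    F \subset matchings n k.+1 n -> t_intersecting t F ->
    (n - t)`! ^ k <= #|F| ->
  exists2 C, C \in matchings n k.+1 t & F = star C.
Proof.
move=> k_gt0 s_gt0 sD nD qD num tn qt FpM tF leF.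
pose R := D ^ k; have D_gt0 : 0 < D by lia.
have leDR : D <= R by rewrite -{1}[D]expn1 leq_pexp2l.
have R_gt0 : 0 < R := leq_trans D_gt0 leDR.
pose S := spread_cores R q F; pose L := uncovered S F.
(* The size of a star over a matching of size [t.+1], the scale against which all remainders are
   compared. *)
pose W := (n - t.+1)`! ^ k; have W_gt0 : 0 < W by rewrite expn_gt0 fact_gt0.
have L_lt : #|L| < W.
  have [->|Ln0] := eqVneq L set0; first by rewrite cards0.
  have [B [qB /set0Pn[M]]] := uncovered_link R_gt0 Ln0.
  rewrite inE => /andP[LM sBM] leL.
  have FM : M \in F by move: LM; rewrite inE => /andP[].
  have /matchingsP[szM _] := subsetP FpM M FM.
  have szB : #|B| <= n by rewrite -[leqRHS]szM subset_leq_card.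
  apply: leq_ltn_trans leL _; apply: (@leq_ltn_trans (R ^ #|B| * #|star B|)).
    rewrite leq_mul2l; apply/orP; right; apply/subset_leq_card/subsetP=> N.
    rewrite in_star inE => /andP[+ ->]; rewrite inE => /andP[FN _].
    by rewrite (subsetP FpM).
  apply: leq_ltn_trans (leq_mul (leqnn _) (card_star_le B)) _.
  (* Since [R = D ^ k], the required inequality is the [k]-th power of [num]. *)
  by rewrite /R -expnM [k * _]mulnC expnM -expnMn ltn_exp2r // num.
have step : (n - t)`! ^ k = (n - t) ^ k * W.
  by rewrite /W -expnMn; have -> : n - t = (n - t.+1).+1 by lia.
have le_ntW : (n - t) * W <= #|F|.
  apply: leq_trans leF; rewrite step leq_mul2r -{1}[n - t]expn1 leq_pexp2l ?orbT //.
  by lia.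
have szS : {in S, forall B : {set edge n k.+1}, #|B| <= q}.
  by move=> B; rewrite inE => /andP[].
have meetS : {in S &, forall B B' : {set edge n k.+1}, t <= #|B :&: B'|}.
  move=> B1 B2; rewrite !inE.
  move=> /andP[sz1 /existsP[G1 /and4P[sF1 G1n0 /forall_inP in1 sp1]]].
  move=> /andP[sz2 /existsP[G2 /and4P[sF2 G2n0 /forall_inP in2 sp2]]].
  have szF M : M \in F -> #|M| <= n.
    by move=> /(subsetP FpM)/matchingsP[-> _].
  have [||||M GM|M GM|M1 [M2 [GM1 GM2 sM]]] :=
    @spread_pair_meet _ s n R q G1 G2 B1 B2 s_gt0 _ _ _ _ sz1 sz2 G1n0 G2n0 sp1 sp2.
  - exact: leq_ltn_trans tn.
  - exact: leq_trans sD leDR.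
  - by apply: leq_trans nD _; rewrite leq_mul2l leDR orbT.
  - exact: leq_trans qD leDR.
  - by split; [apply: in1 | apply/szF/(subsetP sF1)].
  - by split; [apply: in2 | apply/szF/(subsetP sF2)].
  apply: leq_trans (subset_leq_card sM).
  by apply: tF; [apply: (subsetP sF1) | apply: (subsetP sF2)].
have covered M : M \in F -> M \notin L -> exists2 B, B \in S & B \subset M.
  by move=> FM; rewrite inE FM /= negbK => /exists_inP[B]; exists B.
have [/existsP[C /andP[/eqP szC /forall_inP SC]]|noC] :=
    boolP [exists C : {set edge n k.+1}, (#|C| == t) && [forall B in S, C \subset B]];
  last first.
  (* Here [F] lies in [L] and at most [2 ^ q * q] stars of size at most [W], so |F| < (2^q q + 1) W
     <= (n - t) W, contradicting [le_ntW]. *)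
  have [|P [szP inP coverP]] := nontrivial_cover szS meetS (t := t).
    move=> C szC; have := noC; rewrite negb_exists => /forallP/(_ C).
    by rewrite szC eqxx /= negb_forall_in => /exists_inP[B]; exists B.
  have sF : F \subset L :|: \bigcup_(C in P) star C.
    apply/subsetP=> M FM; rewrite inE; case: (boolP (M \in L)) => //= LM.
    have [B SB sBM] := covered M FM LM; have [C PC sCB] := coverP B SB.
    apply/bigcupP; exists C => //.
    by rewrite in_star (subsetP FpM) // (subset_trans sCB).
  have := leq_trans (subset_leq_card sF) (leq_card_setU _ _).
  have : #|\bigcup_(C in P) star C| <= 2 ^ q * q * W.
    apply: leq_trans (leq_card_bigcup _ _) _.
    apply: leq_trans (leq_mul szP (leqnn W)); rewrite -sum_nat_const.
    by apply: leq_sum => C /inP szC; rewrite /W -szC card_star_le.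
  move=> le1 le2; have := leq_trans le_ntW le2.
  have : (2 ^ q * q).+1 * W <= (n - t) * W by rewrite leq_mul2r qt orbT.
  by rewrite mulSn; move: L_lt le1; clear; lia.
have sF : F \subset L :|: star C.
  apply/subsetP=> M FM; rewrite inE; case: (boolP (M \in L)) => //= LM.
  have [B SB sBM] := covered M FM LM.
  by rewrite in_star (subsetP FpM) // (subset_trans (SC B SB)).
have mC : matching C.
  have /subsetPn[M FM LM] : ~~ (F \subset L).
    apply/negP=> /subset_leq_card leFL; have := leq_ltn_trans leFL L_lt.
    rewrite ltnNge; apply/negP/negPn; apply: leq_trans le_ntW.
    by rewrite leq_pmull // ; lia.
  have := subsetP sF M FM; rewrite inE (negbTE LM) /=; exact: star_matching.
exists C; first by move: mC; rewrite /matching szC.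
have [sFC|/subsetPn[M0 FM0 CM0]] := boolP (F \subset star C).
  by apply/eqP; rewrite eqEcard sFC card_star // szC.
(* As [C] is not inside [M0], a matching in [Av] shares fewer than [t] edges with [M0], so [F]
   misses [Av]; but [Av] has at least [W] elements, more than [L] can make up for. *)
pose Av := [set M in star C | M :&: M0 \subset C].
have pM0 := subsetP FpM M0 FM0.
have W_Av : W <= #|Av|.
  have := card_avoiding_star k_gt0 mC (matchingW pM0); rewrite szC => /(_ tn).
  by rewrite /W subnS.
have sAv : Av \subset star C by apply/subsetP=> M; rewrite inE => /andP[].
have sFL : F \subset L :|: (star C :\: Av).
  apply/subsetP=> M FM; have := subsetP sF M FM; rewrite in_setU in_setU.
  case/orP=> [->//|CM]; apply/orP; right; rewrite in_setD CM andbT.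
  rewrite inE CM /=; apply: contraL (tF M M0 FM FM0) => sMC; rewrite -ltnNge -szC.
  apply: proper_card; rewrite properEneq sMC andbT.
  apply: contra CM0 => /eqP <-; rewrite in_star pM0; exact: subsetIr.
have := leq_trans (subset_leq_card sFL) (leq_card_setU _ _).
have := cardsID Av (star C); rewrite (setIidPr sAv) card_star // szC.
by move: L_lt leF W_Av; clear; lia.
Qed.

(** * Choice of the parameters *)

Lemma square_bracket n r : 0 < r -> r ^ 2 <= n ->
  exists s, [/\ r <= s, s ^ 2 <= n & n <= 4 * s ^ 2].
Proof.
move=> r_gt0 rn; have ex : exists s, s ^ 2 <= n by exists r.
have bound s : s ^ 2 <= n -> s <= n.
  by case: s => // s; apply: leq_trans; rewrite expnS expn1 leq_pmulr.
have [s sn maxs] := ex_maxnP ex bound.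
have rs : r <= s by apply: maxs.
exists s; split=> //; have : ~~ (s.+1 ^ 2 <= n).
  by apply/negP=> /maxs; rewrite ltnn.
rewrite -ltnNge => /ltnW le; apply: leq_trans le _; rewrite -(expnMn 2 s 2) leq_sqr; lia.
Qed.

(** The hypotheses give 4D <= n^(3/4), and [expn_fact_le] bounds the left side by (4D)^b n! / n^b,
    which for large [b] is below n! / n^(t+1). *)
Lemma small_link_bound a D s t n b :
    4 * D = a * s -> 0 < a -> a ^ 2 <= s -> s ^ 2 <= n -> 1 < n -> t < n ->
    4 * t.+1 < b -> b <= n ->
  D ^ b * (n - b)`! < (n - t.+1)`!.
Proof.
move=> def_D a_gt0 as_ sn n_gt1 tn tb bn.
have D4 : (4 * D) ^ 4 <= n ^ 3.
  rewrite def_D expnMn; apply: leq_trans (leq_expl 3 sn).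
  by rewrite -expnM (expnD s 2 4) leq_mul2r (expnM a 2 2) leq_sqr as_ orbT.
(* The threshold 4(t+1) on [b] serves here: 3b/4 + t + 1 < b. Fourth powers keep the exponents
   integral. *)
have key : (4 * D) ^ b * n ^ t.+1 < n ^ b.
  rewrite -(@ltn_exp2r _ _ 4) // expnMn expnAC.
  apply: leq_ltn_trans (leq_mul (leq_expl b D4) (leqnn _)) _.
  rewrite -!expnM -expnD ltn_exp2l //; lia.
have n_b_gt0 : 0 < n ^ b by rewrite expn_gt0 ltnW.
rewrite -(ltn_pmul2l n_b_gt0) mulnCA.
apply: leq_ltn_trans (leq_mul (leqnn _) (expn_fact_le bn)) _.
rewrite mulnA -expnMn [D * 4]mulnC -(ffact_fact tn) mulnA ltn_pmul2r ?fact_gt0 //.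
apply: leq_ltn_trans key; rewrite leq_mul2l ffact_le_expn orbT //.
Qed.

(* For k >= 1 the division %/ below is exact, since m ^_ m = m`!. *)
Theorem theorem3p4 (t : nat) (ht : 1 <= t) :
  exists n0 : nat, t <= n0 /\
    forall n k : nat, n0 <= n -> 2 <= k ->
    forall F : {set {set edge n k}},
      F \subset matchings n k n ->
      t_intersecting t F ->
      #|F| <= ((n - t) ^_ (n - t)) ^ k %/ (n - t)`! /\
      (#|F| = ((n - t) ^_ (n - t)) ^ k %/ (n - t)`! <-> t_star t F).
Proof.
(* [D] will be [2048 * s], where 2048 = 4 * 512 because n <= 4 s^2, and [a] is 4D/s. The existential
   keeps this number opaque. *)
have [a def_a] : exists a, a = 4 * 2048 by exists (4 * 2048).
pose q := 4 * t.+1; pose r := a ^ 2 + q.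
(* The term [r ^ 2] yields [r <= s], hence a^2 <= s and q <= s; the rest secures [t.+2 <= n] and
   [2 ^ q * q < n - t]. From here on there are [k.+2] parts. *)
exists (r ^ 2 + t + 2 ^ q * q + 2); split=> [|n [|[|k]] // le_n _ F FpM tF]; first by lia.
have r_gt0 : 0 < r by rewrite /r /q; lia.
have [s [rs sn ns]] : exists s, [/\ r <= s, s ^ 2 <= n & n <= 4 * s ^ 2].
  by apply: square_bracket => //; lia.
have a_gt0 : 0 < a by rewrite def_a.
rewrite ffactnn expnSr mulnK ?fact_gt0 //.
have starF : (n - t)`! ^ k.+1 <= #|F| ->
    exists2 C, C \in matchings n k.+2 t & F = star C.
  move=> leF; apply: (@extremal_star n k.+1 t s q (2048 * s)) => //; try lia.
  move=> b qb bn; apply: (small_link_bound (a := a)) sn _ _ qb bn => //; last 3 first.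
  - by apply: leq_trans rs; apply: leq_addr.
  - by lia.
  - by lia.
  by rewrite def_a mulnA.
have card_starF C : C \in matchings n k.+2 t -> #|star C| = (n - t)`! ^ k.+1.
  move=> mC; rewrite card_star ?(matchingW mC) //; by case/matchingsP: mC => ->.
split.
  rewrite leqNgt; apply/negP=> ltF; have [C mC eqF] := starF (ltnW ltF).
  by move: ltF; rewrite eqF (card_starF C mC) ltnn.
split=> [eqF|[C mC eqF]]; last by rewrite -(card_starF C mC) eqF.
by have [|C mC eqFC] := starF; [rewrite eqF | exists C].
Qed.
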